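(* Let $D$ be a bounded domain in $\mathbb C^N$. Then the identity mapping $\mathrm{id}_D:D\to D$ is $m$-extremal for every $m\ge2$.
   Context: Let $D$ be a bounded domain in $\mathbb C^N$, $\Omega$ a domain in $\mathbb C^M$, $m\ge2$, $\lambda_1,\dots,\lambda_m\in D$ pairwise different and $z_1,\dots,z_m\in\Omega$. The interpolation data $\lambda_j\mapsto z_j$, $D\to\Omega$, $j=1,\dots,m$, are extremally solvable if there is a holomorphic map $h:D\to\Omega$ with $h(\lambda_j)=z_j$, $j=1,\dots,m$, and for every open neighbourhood $U$ of $\overline D$ there is no holomorphic map $f:U\to\Omega$ with $f(\lambda_j)=z_j$, $j=1,\dots,m$. A holomorphic map $h:D\to\Omega$ is $m$-extremal if for all choices of $m$ pairwise distinct points $\lambda_1,\dots,\lambda_m\in D$ the interpolation data $\lambda_j\mapsto h(\lambda_j)$, $D\to\Omega$, $j=1,\dots,m$, are extremally solvable. *)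

(* Defs.v *)
From HB Require Import structures.
From mathcomp Require Import all_boot all_order all_algebra complex.
From mathcomp Require Import all_classical all_reals all_analysis.

Set Implicit Arguments.
Unset Strict Implicit.
Unset Printing Implicit Defensive.

Import Order.TTheory GRing.Theory Num.Theory.
Import numFieldNormedType.Exports.

Local Open Scope classical_set_scope.
Local Open Scope ring_scope.
Local Open Scope complex_scope.

(* The generic topology and norm of a numFieldType are only canonical on
   abstract fields; this makes them canonical on the complex numbers R[i].
   The space C^N is 'rV[R[i]]_N, whose norm is the maximum norm. *)
HB.instance Definition _ (R : rcfType) := NormedModule.copy R[i] (R[i]^o).

Definition domain (R : realType) (N : nat) (D : set 'rV[R[i]]_N) : Prop :=
  [/\ D !=set0, open D & connected D].

(* A map U -> Omega is represented by a total function, of which only the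
   values on U matter: U is meant to be open, so that differentiability at a
   point of U is a condition on the restriction to U.  Over the field R[i],
   [differentiable] is complex (Frechet) differentiability. *)
Definition holomorphic_map (R : realType) (N M : nat) (U : set 'rV[R[i]]_N)
    (Omega : set 'rV[R[i]]_M) (f : 'rV[R[i]]_N -> 'rV[R[i]]_M) : Prop :=
  (forall x, U x -> Omega (f x)) /\ (forall x, U x -> differentiable f x).

Definition extremally_solvable (R : realType) (N M m : nat)
    (D : set 'rV[R[i]]_N) (Omega : set 'rV[R[i]]_M)
    (lambda : 'I_m -> 'rV[R[i]]_N) (z : 'I_m -> 'rV[R[i]]_M) : Prop :=
  (exists h, holomorphic_map D Omega h /\ forall j, h (lambda j) = z j) /\
  (forall U, open U -> closure D `<=` U ->
     ~ exists f, holomorphic_map U Omega f /\ forall j, f (lambda j) = z j).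

Definition m_extremal (R : realType) (N M m : nat)
    (D : set 'rV[R[i]]_N) (Omega : set 'rV[R[i]]_M)
    (h : 'rV[R[i]]_N -> 'rV[R[i]]_M) : Prop :=
  holomorphic_map D Omega h /\
  forall lambda : 'I_m -> 'rV[R[i]]_N,
    (forall j, D (lambda j)) -> injective lambda ->
    extremally_solvable D Omega lambda (fun j => h (lambda j)).

(* Main.v *)
Require Import Defs.
From mathcomp Require Import all_boot all_order all_algebra complex.
From mathcomp Require Import all_classical all_reals all_analysis.
From mathcomp Require Import ring lra.

Set Implicit Arguments.
Unset Strict Implicit.
Unset Printing Implicit Defensive.

Import Order.TTheory GRing.Theory Num.Theory.
Import numFieldNormedType.Exports.
Import ComplexField.Normc.

Local Open Scope classical_set_scope.
Local Open Scope ring_scope.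
Local Open Scope complex_scope.

Local Notation mu := (@lebesgue_measure _).

(** Let f map a neighbourhood of the closure of D into D and fix two distinct
points a and b of D; this has to be refuted.  Since D is bounded, its closure is
compact, hence f maps D into a compact subset of D.  Such a map strictly
contracts an invariant distance, so it cannot have two fixed points.  The
argument below plays this out on one concrete extremal quantity.

Consider the functions g that are holomorphic on D with |Re g| <= 1 and
Re (g a) = 0, and let S be the supremum of Re (g b) over all of them.  By
Harnack's inequality, applied to the positive functions 1 + Re g and 1 - Re g,
there is a d > 0 that does not depend on g such that |Re g| <= 1 - d on the
compact image of f.  Hence g o f, rescaled by a factor larger than 1, is again
in the family; as f fixes a and b, the value at b has been multiplied by that
factor, so that S <= 0 ([fixed_points_not_separated]).  On the other hand a
suitably scaled affine function of one coordinate shows S > 0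
([exists_bounded_separating_function]).

The Harnack inequality is local ([Harnack_local]); it spreads over D because D
is connected ([Harnack_connected]) and becomes uniform on the image of f by
compactness ([Harnack_compact_image]).  Locally, it is an estimate along complex
lines: if g is holomorphic near the closed unit disc and Re g >= 0 there, then
Re g'(0) >= -2 Re g(0) ([derivative_lower_bound]), and integrating this
differential inequality along a segment bounds Re g at one end by a multiple of
its value at the other ([Harnack_segment]).

The derivative estimate comes from the fact that the mean of
(g(z) - g(0)) (2 + z + 1/z) over the circle |z| = r does not depend on r in
]0, 1].  It tends to g'(0) as r tends to 0, and on |z| = 1 the second factor is
the nonnegative real number 2 + 2 cos t.  Holomorphic means here differentiable
at every point, with no continuity of the derivative, so that the independence
of r needs Goursat's argument: in the logarithmic coordinate z = exp (s + it) it
is the vanishing of the integral of a closed form along the boundary of a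
rectangle ([Goursat_rectangle]). *)

(** * Closed forms on rectangles *)

Lemma nested_intervals {R : realType} (u v : nat -> R) :
  (forall n, u n <= u n.+1) -> (forall n, v n.+1 <= v n) ->
  (forall n, u n <= v n) -> exists p, forall n, u n <= p <= v n.
Proof.
move=> uS vS uv.
have u_nd m n : (m <= n)%N -> u m <= u n.
  by move/subnK<-; elim: (n - m)%N => // k /le_trans; apply.
have v_ni m n : (m <= n)%N -> v n <= v m.
  by move/subnK<-; elim: (n - m)%N => // k IH; exact: le_trans (vS _) IH.
have u_le_v m n : u m <= v n.
  have [mn|/ltnW nm] := leqP m n; first exact: le_trans (u_nd _ _ mn) (uv n).
  exact: le_trans (uv m) (v_ni _ _ nm).
have ubv n : ubound (range u) (v n) by move=> _ [m _ <-].
exists (sup (range u)) => n; apply/andP; split.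
  by apply: ub_le_sup; [exists (v 0%N) | exists n].
by apply: ge_sup => //; exists (u 0%N), 0%N.
Qed.

Lemma exists_half_power_lt {R : realType} (A e : R) : 0 < e ->
  exists n, A / 2 ^+ n < e.
Proof.
move=> e0; have [k] : exists k : nat, A / e < k%:R.
  by exists (Num.truncn `|A / e|).+1; rewrite (le_lt_trans (ler_norm _))// truncnS_gt.
move=> Ak; exists k; rewrite ltr_pdivrMr ?exprn_gt0//.
rewrite mulrC -ltr_pdivrMr//; apply: (lt_le_trans Ak).
by rewrite -natrX ler_nat ltnW// ltn_expl.
Qed.

Lemma exists_large_quadrant {R : realType} (F : R -> R -> R -> R -> R)
    (x1 x2 x3 y1 y2 y3 c : R) :
  F x1 x3 y1 y3 = F x1 x2 y1 y3 + F x2 x3 y1 y3 ->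
  F x1 x2 y1 y3 = F x1 x2 y1 y2 + F x1 x2 y2 y3 ->
  F x2 x3 y1 y3 = F x2 x3 y1 y2 + F x2 x3 y2 y3 ->
  4 * c < `|F x1 x3 y1 y3| ->
  [\/ c < `|F x1 x2 y1 y2|, c < `|F x1 x2 y2 y3|,
      c < `|F x2 x3 y1 y2| | c < `|F x2 x3 y2 y3|].
Proof.
move=> -> -> -> big.
have [|h1] := ltP c `|F x1 x2 y1 y2|; first by constructor 1.
have [|h2] := ltP c `|F x1 x2 y2 y3|; first by constructor 2.
have [|h3] := ltP c `|F x2 x3 y1 y2|; first by constructor 3.
have [|h4] := ltP c `|F x2 x3 y2 y3|; first by constructor 4.
move: big; rewrite ltNge => /negP[]; apply: (le_trans (ler_normD _ _)).
apply: (le_trans (lerD (ler_normD _ _) (ler_normD _ _))).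
by move: h1 h2 h3 h4; clear; lra.
Qed.

(** Goursat's subdivision argument, detached from integration.  If F were not
zero on the whole rectangle, it would exceed e L^2 for some e > 0, where L is
the sum of the two side lengths.  Halving both sides divides L^2 by four, so
one of the four quadrants is again too large with the same e; iterating yields
nested rectangles that shrink to a point, where the local hypothesis fails. *)
Lemma additive_rectangle_function_eq0 {R : realType}
    (F : R -> R -> R -> R -> R) (s1 s2 t1 t2 : R) :
  s1 <= s2 -> t1 <= t2 ->
  (forall a m b c d, s1 <= a -> a <= m -> m <= b -> b <= s2 ->
     t1 <= c -> c <= d -> d <= t2 -> F a b c d = F a m c d + F m b c d) ->
  (forall a b c m d, s1 <= a -> a <= b -> b <= s2 ->
     t1 <= c -> c <= m -> m <= d -> d <= t2 ->
     F a b c d = F a b c m + F a b m d) ->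
  (forall p q, s1 <= p <= s2 -> t1 <= q <= t2 -> forall e, 0 < e ->
     exists2 r, 0 < r & forall a b c d, s1 <= a -> a <= p <= b -> b <= s2 ->
       t1 <= c -> c <= q <= d -> d <= t2 -> b - a < r -> d - c < r ->
       `|F a b c d| <= e * ((b - a) + (d - c)) ^+ 2) ->
  F s1 s2 t1 t2 = 0.
Proof.
move=> s12 t12 addl addr loc; apply: contrapT => /eqP F0.
pose A := s2 - s1; pose B := t2 - t1; pose L := A + B.
have A0 : 0 <= A by rewrite subr_ge0.
have B0 : 0 <= B by rewrite subr_ge0.
pose e := `|F s1 s2 t1 t2| / (L ^+ 2 + 1).
have L0 : 0 < L ^+ 2 + 1 by rewrite ltr_wpDl ?sqr_ge0.
have e0 : 0 < e by rewrite divr_gt0// normr_gt0.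
have eL : e * L ^+ 2 < `|F s1 s2 t1 t2|.
  by rewrite /e mulrAC ltr_pdivrMr// ltr_pM2l ?normr_gt0// ltrDl.
(* A cell is given by its lower left corner and its generation n. *)
pose cell n (x : R * R) :=
  F x.1 (x.1 + A / 2 ^+ n) x.2 (x.2 + B / 2 ^+ n).
pose inside n (x : R * R) := [/\ s1 <= x.1, x.1 + A / 2 ^+ n <= s2, t1 <= x.2
   & x.2 + B / 2 ^+ n <= t2].
pose bad n x := inside n x /\ e * (L / 2 ^+ n) ^+ 2 < `|cell n x|.
pose sub n (x y : R * R) := [/\ x.1 <= y.1,
  y.1 + A / 2 ^+ n.+1 <= x.1 + A / 2 ^+ n, x.2 <= y.2
  & y.2 + B / 2 ^+ n.+1 <= x.2 + B / 2 ^+ n].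
have step n x : bad n x -> exists y, bad n.+1 y /\ sub n x y.
  case: x => x y [[/= h1 h2 h3 h4]]; rewrite /cell /= => hF.
  pose a := A / 2 ^+ n.+1; pose b := B / 2 ^+ n.+1.
  have Aa : A / 2 ^+ n = a + a.
    by rewrite /a exprSr; field; rewrite expf_neq0.
  have Bb : B / 2 ^+ n = b + b.
    by rewrite /b exprSr; field; rewrite expf_neq0.
  have Lab : L / 2 ^+ n = 2 * (L / 2 ^+ n.+1).
    by rewrite exprSr; field; rewrite expf_neq0.
  have a0 : 0 <= a by rewrite divr_ge0// exprn_ge0.
  have b0 : 0 <= b by rewrite divr_ge0// exprn_ge0.
  have Lc : e * (L / 2 ^+ n) ^+ 2 = 4 * (e * (L / 2 ^+ n.+1) ^+ 2).
    by rewrite Lab; ring.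
  have good z w : x <= z -> z + a <= x + (a + a) -> y <= w ->
      w + b <= y + (b + b) -> e * (L / 2 ^+ n.+1) ^+ 2 < `|F z (z + a) w (w + b)| ->
      exists y0, bad n.+1 y0 /\ sub n (x, y) y0.
    move=> xz zx yw wy big; exists (z, w).
    rewrite /sub /bad /inside /cell /= -/a -/b Aa Bb.
    rewrite Aa in h2; rewrite Bb in h4.
    split; last by split.
    split=> //; split; [exact: le_trans xz|exact: le_trans h2|
      exact: le_trans yw|exact: le_trans h4].
  move: hF; rewrite Aa Bb Lc !addrA => hF.
  rewrite Aa in h2; rewrite Bb in h4.
  move: a b a0 b0 {Aa Bb} h2 h4 hF good => a b a0 b0 h2 h4 hF good.
  have hx : x + a <= s2 /\ y + b <= t2.
    by move: h2 h4 a0 b0; clear; split; lra.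
  have [xa xaa yb ybb] : [/\ x <= x + a, x + a <= x + a + a, y <= y + b
      & y + b <= y + b + b] by rewrite !lerDl.
  have [yyb xxa] := (le_trans yb ybb, le_trans xa xaa).
  have s1a := le_trans h1 xa.
  rewrite !addrA in h2 h4 good.
  have [||||||] := @exists_large_quadrant _ F x (x + a) (x + a + a) y (y + b)
    (y + b + b) (e * (L / 2 ^+ n.+1) ^+ 2) _ _ _ hF.
  - exact: addl.
  - by apply: addr => //; exact: hx.1.
  - exact: addr.
  - exact: good.
  - exact: good.
  - exact: good.
  - exact: good.
have /choice [nxt nxtP] : forall nx : nat * (R * R),
    exists y, bad nx.1 nx.2 -> bad nx.1.+1 y /\ sub nx.1 nx.2 y.
  move=> [n x]; have [bx|] := pselect (bad n x); last by exists x.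
  by have [y] := step n x bx; exists y.
pose fix X n := if n is k.+1 then nxt (k, X k) else (s1, t1).
have badX n : bad n (X n).
  elim: n => [|n IH]; last exact: (nxtP (n, X n) IH).1.
  split; first by split; rewrite //= divr1 subrKC.
  by rewrite /cell /= !divr1 /A /B !subrKC.
have subX n : sub n (X n) (X n.+1) by exact: (nxtP (n, X n) (badX n)).2.
have half_ge0 (C : R) n : 0 <= C -> 0 <= C / 2 ^+ n.
  by move=> C0; rewrite divr_ge0// exprn_ge0.
have [p pX] : exists p, forall n, (X n).1 <= p <= (X n).1 + A / 2 ^+ n.
  by apply: nested_intervals => n; [case: (subX n)|case: (subX n)|
    rewrite lerDl half_ge0].
have [q qX] : exists q, forall n, (X n).2 <= q <= (X n).2 + B / 2 ^+ n.
  by apply: nested_intervals => n; [case: (subX n)|case: (subX n)|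
    rewrite lerDl half_ge0].
have [|| r r0 hr] := loc p q _ _ e e0.
- by have := pX 0%N; rewrite /= divr1 /A subrKC.
- by have := qX 0%N; rewrite /= divr1 /B subrKC.
have [n Ln] := exists_half_power_lt L r0.
have [[i1 i2 i3 i4]] := badX n; apply/negP; rewrite -leNgt.
have [An Bn] := (half_ge0 A n A0, half_ge0 B n B0).
have Lr : A / 2 ^+ n + B / 2 ^+ n < r by rewrite -mulrDl.
have := hr (X n).1 ((X n).1 + A / 2 ^+ n) (X n).2 ((X n).2 + B / 2 ^+ n).
rewrite ![_ + _ - _]addrAC !subrr !add0r /L (mulrDl A B); apply => //.
- by apply: le_lt_trans Lr; rewrite lerDl.
- by apply: le_lt_trans Lr; rewrite lerDr.
Qed.

(** The total derivative at a single point, with explicit partial derivatives a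
and b: closedness of a form is an equation between such coefficients. *)
Definition has_differential {R : realType} (F : R -> R -> R) (s t a b : R) :=
  forall e, 0 < e -> exists2 r, 0 < r & forall s' t',
    `|s' - s| < r -> `|t' - t| < r ->
    `|F s' t' - F s t - a * (s' - s) - b * (t' - t)|
      <= e * (`|s' - s| + `|t' - t|).

Lemma has_differential_continuousr {R : realType} (F : R -> R -> R) s t a b :
  has_differential F s t a b -> {for t, continuous (F s)}.
Proof.
move=> dF; apply/cvgrPdist_le => e e0.
have [r r0 hr] := dF 1 ltr01.
have b0 : 0 < 1 + `|b| by rewrite ltr_pwDl.
apply/nbhs_ballP; exists (Num.min r (e / (1 + `|b|))) => /=.
  by rewrite lt_min r0 divr_gt0.
move=> t'; rewrite /ball /= distrC lt_min ltr_pdivlMr// => /andP[tr te].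
have := hr s t'; rewrite subrr normr0 => /(_ r0 tr).
rewrite mulr0 subr0 add0r mul1r => h.
rewrite distrC; apply: le_trans (ltW te).
rewrite -[F s t' - F s t](subrK (b * (t' - t))) (mulrDr `|_|) mulr1.
by rewrite (le_trans (ler_normD _ _))// normrM lerD// mulrC.
Qed.

Lemma has_differential_continuousl {R : realType} (F : R -> R -> R) s t a b :
  has_differential F s t a b -> {for s, continuous (F ^~ t)}.
Proof.
move=> dF; apply: (@has_differential_continuousr _ (fun x y => F y x) t s b a).
move=> e e0; have [r r0 hr] := dF e e0; exists r => // s' t' hs ht.
by rewrite [_ + `|t' - s|]addrC addrAC; exact: hr.
Qed.

Lemma continuous_integrable_itv {R : realType} (f : R -> R) (a b : R) :
  (forall x, a <= x <= b -> {for x, continuous f}) ->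
  mu.-integrable `[a, b] (EFin \o f).
Proof.
move=> cf; apply: continuous_compact_integrable; first exact: segment_compact.
apply: continuous_in_subspaceT => x; rewrite inE/= in_itv/=; exact: cf.
Qed.

Lemma Rintegral_itvD {R : realType} (f : R -> R) (a m b : R) :
  a <= m -> m <= b -> (forall x, a <= x <= b -> {for x, continuous f}) ->
  \int[mu]_(x in `[a, b]) f x =
  \int[mu]_(x in `[a, m]) f x + \int[mu]_(x in `[m, b]) f x.
Proof.
move=> am mb cf.
have fi := continuous_integrable_itv cf.
have := @Rintegral_itvB R f (BLeft a) (BRight b) m fi.
rewrite !bnd_simp => /(_ am mb) /eqP; rewrite subr_eq addrC => /eqP ->.
congr (_ + _); apply: Rintegral_itv_obnd_cbnd.
by apply: integrableS fi => //; apply: subset_itvr; rewrite bnd_simp.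
Qed.

Lemma Rintegral_itv_dist {R : realType} (f : R -> R) (a b k e : R) :
  a <= b -> (forall x, a <= x <= b -> {for x, continuous f}) ->
  (forall x, a <= x <= b -> `|f x - k| <= e) ->
  `|\int[mu]_(x in `[a, b]) f x - k * (b - a)| <= e * (b - a).
Proof.
move=> ab cf fk; have fi := continuous_integrable_itv cf.
have cst_int (c : R) : \int[mu]_(x in `[a, b]) c = c * (b - a).
  rewrite Rintegral_cst//= lebesgue_measure_itv/= lte_fin.
  by case: ltgtP ab => // ->; rewrite subrr.
have ci (c : R) : mu.-integrable `[a, b] (EFin \o cst c).
  by apply: continuous_integrable_itv => x _; exact: cvg_cst.
rewrite ler_distl; apply/andP; split.
- rewrite -mulrBl -cst_int; apply: le_Rintegral => //; first exact: ci.
  by move=> x; rewrite /= in_itv/= => /fk; rewrite ler_distl => /andP[].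
- rewrite -mulrDl -cst_int; apply: le_Rintegral => //; first exact: ci.
  by move=> x; rewrite /= in_itv/= => /fk; rewrite ler_distl => /andP[].
Qed.

(** P ds + Q dt is a closed form whose coefficients are only assumed to be
differentiable at each point, with dP/dt = dQ/ds = k; its integral along the
boundary of the rectangle vanishes.  On a small rectangle near a given point, with L the sum of the side
lengths, both integrals are k times the area up to o(L^2), whence their
difference is small enough for [additive_rectangle_function_eq0]. *)
Lemma Goursat_rectangle {R : realType} (P Q : R -> R -> R) (s1 s2 t1 t2 : R) :
  s1 <= s2 -> t1 <= t2 ->
  (forall s t, s1 <= s <= s2 -> t1 <= t <= t2 -> exists a k b,
     has_differential P s t a k /\ has_differential Q s t k b) ->
  \int[mu]_(t in `[t1, t2]) (Q s2 t - Q s1 t) =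
  \int[mu]_(s in `[s1, s2]) (P s t2 - P s t1).
Proof.
move=> s12 t12 dPQ.
have Qc s t : s1 <= s <= s2 -> t1 <= t <= t2 -> {for t, continuous (Q s)}.
  move=> hs ht; have [a [k [b [_ dQ]]]] := dPQ _ _ hs ht.
  exact: has_differential_continuousr dQ.
have Pc s t : s1 <= s <= s2 -> t1 <= t <= t2 -> {for s, continuous (P ^~ t)}.
  move=> hs ht; have [a [k [b [dP _]]]] := dPQ _ _ hs ht.
  exact: has_differential_continuousl dP.
have QBc a b t : s1 <= a <= s2 -> s1 <= b <= s2 -> t1 <= t <= t2 ->
    {for t, continuous (fun t => Q b t - Q a t)}.
  by move=> ha hb ht; apply: cvgB; exact: Qc.
have PBc c d s : t1 <= c <= t2 -> t1 <= d <= t2 -> s1 <= s <= s2 ->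
    {for s, continuous (fun s => P s d - P s c)}.
  by move=> ha hb ht; apply: cvgB; exact: Pc.
pose F a b c d := \int[mu]_(t in `[c, d]) (Q b t - Q a t) -
                  \int[mu]_(s in `[a, b]) (P s d - P s c).
have rng (l h c d x : R) : l <= c -> d <= h -> c <= x <= d -> l <= x <= h.
  by move=> lc dh /andP[cx xd]; rewrite (le_trans lc) ?(le_trans xd).
suff /eqP : F s1 s2 t1 t2 = 0 by rewrite subr_eq0 => /eqP.
apply: additive_rectangle_function_eq0 => //.
- move=> a m b c d s1a am mb bs2 t1c cd dt2; rewrite /F.
  have [ab mb2] := (le_trans am mb, le_trans mb bs2).
  have ct : t1 <= c <= t2 by rewrite t1c (le_trans cd).
  have dt : t1 <= d <= t2 by rewrite dt2 (le_trans t1c).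
  have as12 : s1 <= a <= s2 by rewrite s1a (le_trans ab).
  have bs12 : s1 <= b <= s2 by rewrite bs2 (le_trans s1a).
  have ms12 : s1 <= m <= s2 by rewrite mb2 (le_trans s1a).
  rewrite [X in _ - X](@Rintegral_itvD _ _ _ m)//; last first.
    by move=> x hx; apply: PBc => //; exact: rng hx.
  have -> : \int[mu]_(t in `[c, d]) (Q b t - Q a t) =
      \int[mu]_(t in `[c, d]) (Q m t - Q a t) +
      \int[mu]_(t in `[c, d]) (Q b t - Q m t).
    rewrite -RintegralD//.
    + by apply: eq_Rintegral => t _; rewrite /=; ring.
    + by apply: continuous_integrable_itv => t ht; apply: QBc => //; exact: rng ht.
    + by apply: continuous_integrable_itv => t ht; apply: QBc => //; exact: rng ht.
  by ring.
- move=> a b c m d s1a ab bs2 t1c cm md dt2; rewrite /F.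
  have [cd mt2] := (le_trans cm md, le_trans md dt2).
  have ct : t1 <= c <= t2 by rewrite t1c (le_trans cd).
  have dt : t1 <= d <= t2 by rewrite dt2 (le_trans t1c).
  have mt : t1 <= m <= t2 by rewrite mt2 (le_trans t1c).
  have as12 : s1 <= a <= s2 by rewrite s1a (le_trans ab).
  have bs12 : s1 <= b <= s2 by rewrite bs2 (le_trans s1a).
  rewrite [X in X - _](@Rintegral_itvD _ _ _ m)//; last first.
    by move=> x hx; apply: QBc => //; exact: rng hx.
  have -> : \int[mu]_(s in `[a, b]) (P s d - P s c) =
      \int[mu]_(s in `[a, b]) (P s m - P s c) +
      \int[mu]_(s in `[a, b]) (P s d - P s m).
    rewrite -RintegralD//.
    + by apply: eq_Rintegral => s _; rewrite /=; ring.
    + by apply: continuous_integrable_itv => s hs; apply: PBc => //; exact: rng hs.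
    + by apply: continuous_integrable_itv => s hs; apply: PBc => //; exact: rng hs.
  by ring.
move=> p q hp hq e e0; have [al [k [be [dP dQ]]]] := dPQ _ _ hp hq.
have e2 : 0 < e / 2 by rewrite divr_gt0.
have [rP rP0 hP] := dP _ e2; have [rQ rQ0 hQ] := dQ _ e2.
exists (Num.min rP rQ); first by rewrite lt_min rP0.
move=> a b c d s1a /andP[ap pb] bs2 t1c /andP[cq qd] dt2.
rewrite !lt_min => /andP[abP abQ] /andP[cdP cdQ].
have [ab cd] := (le_trans ap pb, le_trans cq qd).
have ct : t1 <= c <= t2 by rewrite t1c (le_trans cd).
have dt : t1 <= d <= t2 by rewrite dt2 (le_trans t1c).
have as12 : s1 <= a <= s2 by rewrite s1a (le_trans ab).
have bs12 : s1 <= b <= s2 by rewrite bs2 (le_trans s1a).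
have dist (l h x y : R) : l <= x <= h -> l <= y <= h -> `|x - y| <= h - l.
  move=> /andP[lx xh] /andP[ly yh]; rewrite ler_norml; apply/andP; split; lra.
pose L := (b - a) + (d - c).
have distL x y : a <= x <= b -> c <= y <= d ->
    `|x - p| <= b - a /\ `|y - q| <= d - c.
  by move=> hx hy; split; apply: dist; rewrite ?ap ?cq.
have near_Q x y : a <= x <= b -> c <= y <= d ->
    `|Q x y - Q p q - k * (x - p) - be * (y - q)| <= e / 2 * L.
  move=> hx hy; have [dx dy] := distL _ _ hx hy.
  apply: (le_trans (hQ _ _ (le_lt_trans dx abQ) (le_lt_trans dy cdQ))).
  by rewrite ler_pM2l// lerD.
have near_P x y : a <= x <= b -> c <= y <= d ->
    `|P x y - P p q - al * (x - p) - k * (y - q)| <= e / 2 * L.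
  move=> hx hy; have [dx dy] := distL _ _ hx hy.
  apply: (le_trans (hP _ _ (le_lt_trans dx abP) (le_lt_trans dy cdP))).
  by rewrite ler_pM2l// lerD.
have [aI bI] : a <= a <= b /\ a <= b <= b by rewrite !lexx !ab.
have [cI dI] : c <= c <= d /\ c <= d <= d by rewrite !lexx !cd.
have intQ : `|\int[mu]_(t in `[c, d]) (Q b t - Q a t) -
    k * (b - a) * (d - c)| <= e * L * (d - c).
  apply: Rintegral_itv_dist => // t ht; first by apply: QBc => //; exact: rng ht.
  have := near_Q _ _ bI ht; have := near_Q _ _ aI ht.
  rewrite !ler_norml; clear; lra.
have intP : `|\int[mu]_(s in `[a, b]) (P s d - P s c) -
    k * (d - c) * (b - a)| <= e * L * (b - a).
  apply: Rintegral_itv_dist => // s hs; first by apply: PBc => //; exact: rng hs.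
  have := near_P _ _ hs cI; have := near_P _ _ hs dI.
  rewrite !ler_norml; clear; lra.
have -> : e * (b - a + (d - c)) ^+ 2 = e * L * (d - c) + e * L * (b - a).
  by rewrite /L; ring.
rewrite mulrAC in intP; rewrite /F.
by move: intQ intP; rewrite !ler_norml; clear; lra.
Qed.

(** * Estimates for complex differentiable functions *)

Lemma normC_normc {R : rcfType} (z : R[i]) : `|z| = (normc z)%:C.
Proof. by []. Qed.

Lemma normc_ge0 {R : rcfType} (z : R[i]) : 0 <= normc z.
Proof. by rewrite -ler0c -normC_normc. Qed.

Lemma normcD {R : rcfType} (z w : R[i]) : normc (z + w) <= normc z + normc w.
Proof. exact: le_normcD. Qed.

Lemma normc_le_ReIm {R : rcfType} (z : R[i]) :
  normc z <= `|complex.Re z| + `|complex.Im z|.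
Proof.
case: z => a b /=; rewrite -[leRHS]ger0_norm ?addr_ge0// -[leRHS]sqrtr_sqr.
rewrite ler_wsqrtr// sqrrD !real_normK ?num_real// lerD2r lerDl.
by rewrite mulrn_wge0// mulr_ge0.
Qed.

Lemma ReIm_le_normc {R : rcfType} (z : R[i]) :
  `|complex.Re z| <= normc z /\ `|complex.Im z| <= normc z.
Proof.
case: z => a b /=; split; rewrite -sqrtr_sqr ler_wsqrtr//.
  by rewrite lerDl sqr_ge0.
by rewrite lerDr sqr_ge0.
Qed.

Lemma differentiable_approx {K : numFieldType} {V W : normedModType K}
    (f : V -> W) (x : V) : differentiable f x -> forall e : K, 0 < e ->
  \forall h \near 0, `|f (h + x) - f x - 'd f x h| <= e * `|h|.
Proof.
move=> df e e0; have /eqaddoP/(_ _ e0) := diff_locally df.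
by apply: filterS => h; rewrite !fctE/= opprD addrA.
Qed.

Lemma real_derivative_approx {R : realType} (f : R -> R) (x c : R) :
  is_derive x 1 f c -> forall e, 0 < e -> exists2 r, 0 < r &
    forall h, `|h| < r -> `|f (x + h) - f x - c * h| <= e * `|h|.
Proof.
move=> fc e e0.
have df : differentiable f x by apply/derivable1_diffP; exact: ex_derive.
have /nbhs_ballP[r /= r0 hr] := differentiable_approx df e0.
exists r => // h hh; have := hr h; rewrite /ball/= sub0r normrN => /(_ hh).
by rewrite deriv1E; rewrite ?derive1E ?derive_val ?[h + x]addrC 1?[c * h]mulrC//;
  apply: ex_derive.
Qed.

Lemma complex_derivative_approx {R : realType} (g : R[i] -> R[i]) (z : R[i]) :
  differentiable g z -> forall e, 0 < e -> exists2 r, 0 < r &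
    forall w, normc (w - z) < r ->
    normc (g w - g z - 'd g z 1 * (w - z)) <= e * normc (w - z).
Proof.
move=> dg e e0.
have e0' : 0 < e%:C by rewrite ltcR.
have /nbhs_ballP[r /= r0 hr] := differentiable_approx dg e0'.
have rR : r = (complex.Re r)%:C by rewrite RRe_real// gtr0_real.
exists (complex.Re r); first by rewrite -ltcR -rR.
move=> w hw; have := hr (w - z).
rewrite /ball/= sub0r normrN normC_normc {1}rR ltcR => /(_ hw).
rewrite subrK.
have -> : 'd g z (w - z) = 'd g z 1 * (w - z).
  by rewrite -[w - z in LHS]mulr1 linearZ/= mulrC.
by rewrite !normC_normc -rmorphM lecR.
Qed.

(** * Means over circles *)

(** The exponential exp (s + it).  It parametrizes the punctured unit disc by a
half-plane and the circles around 0 by vertical segments, so that the domain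
between two circles becomes a rectangle. *)
Definition polar {R : realType} (s t : R) : R[i] :=
  (expR s * cos t) +i* (expR s * sin t).

Lemma polarD {R : realType} (s t h k : R) :
  polar (s + h) (t + k) = polar s t * polar h k.
Proof.
apply/eqP; rewrite /polar expRD cosD sinD eq_complex/=.
by apply/andP; split; apply/eqP; ring.
Qed.

Lemma normc_polar {R : realType} (s t : R) : normc (polar s t) = expR s.
Proof.
by rewrite /polar /= !exprMn -mulrDr cos2Dsin2 mulr1 sqrtr_sqr ger0_norm.
Qed.

Lemma polar_approx0 {R : realType} (e : R) : 0 < e -> exists2 r, 0 < r &
  forall h k, `|h| < r -> `|k| < r ->
    normc (polar h k - 1 - (h +i* k)) <= e * (`|h| + `|k|).
Proof.
move=> e0.
(* The error terms below add up to d |h| + 5 d |k|. *)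
pose d := Num.min 1 (e / 5).
have d0 : 0 < d by rewrite lt_min ltr01/= divr_gt0.
have [d1 d5] : d <= 1 /\ d <= e / 5.
  by split; rewrite ge_min lexx ?orbT.
have [r1 r10 h1] := real_derivative_approx (is_derive_expR (0 : R)) d0.
have [r2 r20 h2] := real_derivative_approx (is_derive_cos (0 : R)) d0.
have [r3 r30 h3] := real_derivative_approx (is_derive_sin (0 : R)) d0.
exists (Num.min (Num.min r1 (d / 2)) (Num.min r2 r3)).
  by rewrite !lt_min r10 r20 r30 divr_gt0.
move=> h k; rewrite !lt_min => /andP[/andP[hr1 hd] _] /andP[_ /andP[kr2 kr3]].
have := h1 _ hr1; have := h2 _ kr2; have := h3 _ kr3.
rewrite !add0r expR0 cos0 sin0 subr0 oppr0 mul0r subr0 !mul1r => E3 E2 E1.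
apply: (le_trans (normc_le_ReIm _)); rewrite /polar /=.
have eh1 : `|expR h - 1| <= 2 * `|h|.
  rewrite -[X in `|X|](subrK h) (le_trans (ler_normD _ _))//.
  rewrite mulr_natl mulr2n lerD2r (le_trans E1)// -[leRHS]mul1r ler_wpM2r//.
have eh2 : `|expR h| <= 2.
  rewrite -[X in `|X|](subrK 1) (le_trans (ler_normD _ _))// normr1.
  rewrite -[2]/(1 + 1) lerD2r (le_trans eh1)//; move: hd d1; clear; lra.
have -> : expR h * cos k - 1 - h = (expR h - 1 - h) + expR h * (cos k - 1) by ring.
have -> : expR h * sin k - 0 - k = expR h * (sin k - k) + (expR h - 1) * k by ring.
have b1 : `|expR h * (cos k - 1)| <= 2 * (d * `|k|) by rewrite normrM ler_pM.
have b2 : `|expR h * (sin k - k)| <= 2 * (d * `|k|) by rewrite normrM ler_pM.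
have b3 : `|(expR h - 1) * k| <= d * `|k|.
  rewrite normrM ler_wpM2r// (le_trans eh1)//; move: hd; clear; lra.
apply: (le_trans (lerD (ler_normD _ _) (ler_normD _ _))).
apply: (@le_trans _ _ (5 * d * (`|h| + `|k|))).
  have dh : 0 <= d * `|h| by rewrite mulr_ge0// ltW.
  have dk : 0 <= d * `|k| by rewrite mulr_ge0// ltW.
  by move: E1 b1 b2 b3 dh dk; clear; lra.
by rewrite ler_wpM2r ?addr_ge0// mulrC -ler_pdivlMr.
Qed.

(** The chain rule for G (exp (s + it)), as an estimate in the two real
variables s and t; c is the derivative of the composite in s + it. *)
Lemma polar_comp_approx {R : realType} (G : R[i] -> R[i]) (s t : R) :
  differentiable G (polar s t) -> exists c : R[i], forall e, 0 < e ->
  exists2 r, 0 < r & forall s' t', `|s' - s| < r -> `|t' - t| < r ->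
    normc (G (polar s' t') - G (polar s t) - c * ((s' - s) +i* (t' - t)))
      <= e * (`|s' - s| + `|t' - t|).
Proof.
move=> dG; set z := polar s t in dG *; pose c := 'd G z 1.
exists (c * z) => e e0.
have nz1 : 0 < normc z + 1 by rewrite ltr_wpDl ?normc_ge0.
pose e1 := e / 2 / (normc z + 1).
have e10 : 0 < e1 by rewrite !divr_gt0.
have nc1 : 0 < (normc c + 1) * (normc z + 1).
  by rewrite mulr_gt0// ltr_wpDl ?normc_ge0.
pose e2 := Num.min ((normc z + 1)^-1) (e / 2 / ((normc c + 1) * (normc z + 1))).
have e20 : 0 < e2 by rewrite lt_min invr_gt0 nz1 !divr_gt0.
have [r1 r10 h1] := complex_derivative_approx dG e10.
have [r2 r20 h2] := polar_approx0 e20.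
exists (Num.min r2 (r1 / (2 * (normc z + 1)))).
  by rewrite lt_min r20 divr_gt0// mulr_gt0.
move=> s' t'; rewrite !lt_min => /andP[hs2 hs1] /andP[ht2 ht1].
have := h2 _ _ hs2 ht2.
set h := s' - s in hs1 hs2 *; set k := t' - t in ht1 ht2 *.
set w := polar s' t'; set l := `|h| + `|k|.
have wE : w = z * polar h k.
  by rewrite -polarD /h /k [s + _]addrC [t + _]addrC !subrK.
have l0 : 0 <= l by rewrite addr_ge0.
set q := polar h k - 1 - (h +i* k) => hq.
have dE : w - z - z * (h +i* k) = z * q by rewrite wE /q; ring.
have zq : normc (z * q) <= normc z * (e2 * l).
  by rewrite normcM ler_wpM2l ?normc_ge0.
have wz : normc (w - z) <= (normc z + 1) * l.
  rewrite -[w - z](subrK (z * (h +i* k))) dE.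
  apply: (le_trans (normcD _ _)).
  rewrite [leRHS]mulrDl addrC mul1r lerD//.
    by rewrite normcM ler_wpM2l ?normc_ge0// normc_le_ReIm.
  apply: (le_trans zq); rewrite mulrA -[leRHS]mul1r ler_wpM2r//.
  apply: (@le_trans _ _ (normc z * (normc z + 1)^-1)).
    by rewrite ler_wpM2l ?normc_ge0// ge_min lexx.
  by rewrite ler_pdivrMr// mul1r lerDl.
have wr1 : normc (w - z) < r1.
  apply: (le_lt_trans wz); rewrite mulrC -ltr_pdivlMr//.
  have -> : r1 / (normc z + 1) = r1 / (2 * (normc z + 1)) + r1 / (2 * (normc z + 1)).
    by field; apply: lt0r_neq0.
  exact: ltrD.
have -> : G w - G z - c * z * (h +i* k) = (G w - G z - c * (w - z)) + c * (z * q).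
  by rewrite -dE; ring.
apply: (le_trans (normcD _ _)).
have -> : e * l = e / 2 * l + e / 2 * l by field.
apply: lerD.
  apply: (le_trans (h1 _ wr1)).
  apply: (le_trans (ler_wpM2l (ltW e10) wz)).
  by rewrite /e1 mulrA mulfVK// lt0r_neq0.
rewrite normcM; apply: (le_trans (ler_wpM2l (normc_ge0 _) zq)).
rewrite !mulrA ler_wpM2r//.
apply: (@le_trans _ _ ((normc c + 1) * (normc z + 1) * e2)).
  by rewrite ler_wpM2r ?(ltW e20)// ler_pM ?normc_ge0// lerDl.
by rewrite mulrC -ler_pdivlMr// ge_min lexx orbT.
Qed.

(** The Cauchy-Riemann equations in the coordinates s and t. *)
Lemma polar_comp_differentials {R : realType} (G : R[i] -> R[i]) (s t : R) :
  differentiable G (polar s t) -> exists a b : R,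
    has_differential (fun s t => complex.Re (G (polar s t))) s t a (- b) /\
    has_differential (fun s t => complex.Im (G (polar s t))) s t b a.
Proof.
move=> /polar_comp_approx[[a b] hc]; exists a, b.
split=> e e0; have [r r0 hr] := hc e e0; exists r => // s' t' hs ht;
  apply: le_trans (hr _ _ hs ht);
  have := ReIm_le_normc (G (polar s' t') - G (polar s t) -
                         (a +i* b) * ((s' - s) +i* (t' - t)));
  move: (G (polar s' t')) (G (polar s t)) => [u' v'] [u v] /= [hRe hIm].
- by apply: le_trans hRe; rewrite le_eqVlt; apply/orP; left; apply/eqP;
    congr `|_|; ring.
- by apply: le_trans hIm; rewrite le_eqVlt; apply/orP; left; apply/eqP;
    congr `|_|; ring.
Qed.

Lemma polar_neq0 {R : realType} (s t : R) : polar s t != 0.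
Proof.
apply/eqP => E; have := normc_polar s t; rewrite E normc0 => /esym/eqP.
by rewrite gt_eqF ?expR_gt0.
Qed.

Lemma polar_periodic {R : realType} (s t : R) :
  polar s (t + pi *+ 2) = polar s t.
Proof. by rewrite /polar cosD2pi sinD2pi. Qed.

(** This is 2 pi times the mean of Re G over the circle |z| = exp s. *)
Definition circle_integral {R : realType} (G : R[i] -> R[i]) (s : R) :=
  \int[mu]_(t in `[0, (pi *+ 2 : R)]) complex.Re (G (polar s t)).

Lemma twopi_ge0 {R : realType} : 0 <= pi *+ 2 :> R.
Proof. by rewrite mulrn_wge0// pi_ge0. Qed.

Lemma differentiable_polar {R : realType} (G : R[i] -> R[i]) (s t : R) :
  s <= 0 -> (forall z, z != 0 -> normc z <= 1 -> differentiable G z) ->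
  differentiable G (polar s t).
Proof.
move=> s0; apply; first exact: polar_neq0.
by rewrite normc_polar -expR0 ler_expR.
Qed.

Lemma circle_integrand_continuous {R : realType} (G : R[i] -> R[i]) (s t : R) :
  s <= 0 -> (forall z, z != 0 -> normc z <= 1 -> differentiable G z) ->
  {for t, continuous (fun t => complex.Re (G (polar s t)))}.
Proof.
move=> s0 dG.
have [a [b [dRe _]]] := polar_comp_differentials (differentiable_polar t s0 dG).
exact: has_differential_continuousr dRe.
Qed.

(** In the coordinates s and t the real part of G dz / (i z) is the closed form
Im G ds + Re G dt.  By periodicity its integrals along the two horizontal
sides of the rectangle [s, 0] x [0, 2 pi] cancel, which leaves the two circles. *)
Lemma circle_integral_const {R : realType} (G : R[i] -> R[i]) (s : R) : s <= 0 ->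
  (forall z, z != 0 -> normc z <= 1 -> differentiable G z) ->
  circle_integral G 0 = circle_integral G s.
Proof.
move=> s0 dG.
have := @Goursat_rectangle R (fun s t => complex.Im (G (polar s t)))
  (fun s t => complex.Re (G (polar s t))) s 0 0 (pi *+ 2) s0 twopi_ge0.
rewrite RintegralB//; last 2 first.
- by apply: continuous_integrable_itv => t _; exact: circle_integrand_continuous.
- by apply: continuous_integrable_itv => t _; exact: circle_integrand_continuous.
rewrite [RHS](_ : _ = 0); last first.
  rewrite (@eq_Rintegral _ _ _ _ _ (cst 0)); last first.
    by move=> x _ /=; rewrite -[pi *+ 2]add0r polar_periodic subrr.
  by rewrite Rintegral_cst//= mul0r.
move=> H; apply/eqP; rewrite -subr_eq0; apply/eqP/H => x t /andP[_ x0] _.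
have [a [b [dRe dIm]]] := polar_comp_differentials (differentiable_polar t x0 dG).
by exists b, a, (- b).
Qed.

(** The mean over the unit circle equals the mean over arbitrarily small circles,
hence the limit at the centre.  The punctured disc matters, because G will be a
product with a kernel that has a pole at 0. *)
Lemma circle_integral_limit {R : realType} (G : R[i] -> R[i]) (L : R[i]) :
  (forall z, z != 0 -> normc z <= 1 -> differentiable G z) ->
  (forall e, 0 < e -> exists2 r, 0 < r &
     forall z, z != 0 -> normc z < r -> normc (G z - L) <= e) ->
  circle_integral G 0 = complex.Re L * (pi *+ 2).
Proof.
move=> dG GL; apply/eqP; rewrite -subr_eq0 -normr_le0; apply/ler_addgt0Pl => e e0.
rewrite addr0; pose d := e / (pi *+ 2).
have pi0 : 0 < pi *+ 2 :> R by rewrite mulrn_wgt0// pi_gt0.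
have [|r r0 hr] := GL d; first by rewrite divr_gt0.
pose s := Num.min 0 (ln (r / 2)).
have s0 : s <= 0 by rewrite ge_min lexx.
have sr : expR s < r.
  apply: (@le_lt_trans _ _ (r / 2)); last by rewrite ltr_pdivrMr// mulr_natr mulr2n ltrDl.
  rewrite -[leRHS]lnK ?posrE ?divr_gt0// ler_expR.
  by rewrite ge_min lexx orbT.
rewrite (circle_integral_const s0 dG).
have := @Rintegral_itv_dist R (fun t => complex.Re (G (polar s t))) 0 (pi *+ 2)
  (complex.Re L) d (ltW pi0).
rewrite subr0 => H; apply: le_trans (H _ _) _.
- by move=> t _; exact: circle_integrand_continuous.
- move=> t _; apply: le_trans (hr _ (polar_neq0 s t) _); last by rewrite normc_polar.
  have [+ _] := ReIm_le_normc (G (polar s t) - L).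
  by case: (G _) => ? ?; case: L {GL hr H}.
- by rewrite /d divfK// lt0r_neq0.
Qed.

(** The kernel K z = 2 + z + 1/z is chosen for two reasons: on the unit circle
it is the nonnegative number 2 + 2 cos t, and its simple pole at 0 with residue 1
makes (g z - g 0) K z tend to g'(0), so that Re g'(0) is the mean of
(Re (g z) - Re (g 0)) (2 + 2 cos t).  As Re g >= 0, this is at least - Re (g 0)
times the mean of 2 + 2 cos t, which is 2. *)
Lemma derivative_lower_bound {R : realType} (g : R[i] -> R[i]) :
  (forall z, normc z <= 1 -> differentiable g z) ->
  (forall z, normc z <= 1 -> 0 <= complex.Re (g z)) ->
  - (2 * complex.Re (g 0)) <= complex.Re ('d g 0 1).
Proof.
move=> dg g0; set c := 'd g 0 1; set u0 := complex.Re (g 0).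
have n0 : normc (0 : R[i]) <= 1 by rewrite normc0.
have n2 : normc (2 : R[i]) = 2.
  by apply: complexI; rewrite -normC_normc normr_nat rmorph_nat.
pose K (z : R[i]) := 2 + z + z^-1.
pose G z := (g z - g 0) * K z.
have dG z : z != 0 -> normc z <= 1 -> differentiable G z.
  move=> z0 z1; apply: differentiableM.
    by apply: differentiableB => //; exact: dg.
  apply: differentiableD; first by apply: differentiableD.
  exact: differentiable_Rinv.
have GL e : 0 < e -> exists2 r, 0 < r &
    forall z, z != 0 -> normc z < r -> normc (G z - c) <= e.
  move=> e0; have e8 : 0 < e / 8 by rewrite divr_gt0.
  have [r r0 hr] := complex_derivative_approx (dg _ n0) e8.
  have nc : 0 < 8 * (normc c + 1) by rewrite mulr_gt0// ltr_wpDl ?normc_ge0.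
  exists (Num.min (Num.min r 1) (e / (8 * (normc c + 1)))).
    by rewrite !lt_min r0 ltr01 divr_gt0.
  move=> z z0; rewrite !lt_min => /andP[/andP[zr z1] ze].
  have := hr z; rewrite subr0 => /(_ zr) hz.
  have nz : normc z != 0 by apply: contra z0 => /eqP/eq0_normc ->.
  pose w := z * K z.
  have wE : w = 1 + (2 * z + z * z) by rewrite /w /K; field.
  have -> : G z - c = (g z - g 0 - c * z) * K z + c * (2 * z + z * z).
    by rewrite /G /K; field.
  have b1 : normc (2 * z + z * z) <= 3 * normc z.
    apply: (le_trans (normcD _ _)); rewrite !normcM n2.
    have : normc z * normc z <= normc z by rewrite ler_piMl ?normc_ge0// ltW.
    by clear; lra.
  have b2 : normc (z * K z) <= 4.
    rewrite -/w wE; apply: (le_trans (normcD _ _)); rewrite normc1.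
    by move: b1 z1; clear; lra.
  apply: (le_trans (normcD _ _)).
  have b3 : normc ((g z - g 0 - c * z) * K z) <= e / 2.
    rewrite normcM; apply: (le_trans (ler_wpM2r (normc_ge0 _) hz)).
    rewrite -[leLHS]mulrA -normcM (_ : e / 2 = e / 8 * 4); last by field.
    by rewrite ler_wpM2l// ltW.
  have b4 : normc (c * (2 * z + z * z)) <= e / 2.
    rewrite normcM; apply: (@le_trans _ _ ((normc c + 1) * (3 * normc z))).
      by rewrite ler_pM ?normc_ge0// lerDl.
    move: ze; rewrite ltr_pdivlMr// => ze.
    have : 0 <= (normc c + 1) * normc z by rewrite mulr_ge0 ?addr_ge0 ?normc_ge0.
    by move: ze; clear; lra.
  by move: b3 b4; clear; lra.
have GI := circle_integral_limit dG GL.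
have pi0 : 0 < pi *+ 2 :> R by rewrite mulrn_wgt0// pi_gt0.
(* On the unit circle Re (H z) = - u0 K z, but H is a polynomial, so that the
   mean value 2 of 2 + 2 cos t is one more instance of the limit lemma. *)
pose H (z : R[i]) := (- u0)%:C * (2 + 2 * z).
have dH z : differentiable H z.
  by apply: differentiableM => //; apply: differentiableD => //; apply: differentiableM.
have HI : circle_integral H 0 = complex.Re (H 0) * (pi *+ 2).
  apply: circle_integral_limit => [z _ _|e e0]; first exact: dH.
  have u1 : 0 < 2 * (`|u0| + 1) by rewrite mulr_gt0// ltr_wpDl.
  exists (e / (2 * (`|u0| + 1))); first by rewrite divr_gt0.
  move=> z z0; rewrite ltr_pdivlMr// => ze.
  have -> : H z - H 0 = (- u0)%:C * (2 * z) by rewrite /H; ring.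
  rewrite !normcM n2 /= expr0n/= addr0 sqrtr_sqr normrN.
  have := mulr_ge0 (normr_ge0 u0) (normc_ge0 z); have := normc_ge0 z.
  by move: ze; clear; lra.
suff : circle_integral H 0 <= circle_integral G 0.
  rewrite HI GI ler_pM2r// (_ : complex.Re (H 0) = - (2 * u0))//.
  by rewrite /H mulr0 addr0 /=; ring.
apply: le_Rintegral => //.
- by apply: continuous_integrable_itv => t _; apply: circle_integrand_continuous.
- by apply: continuous_integrable_itv => t _; apply: circle_integrand_continuous.
move=> t _.
have twoE : (2 : R[i]) = 2 +i* 0 by rewrite -[2 +i* 0]/((2 : R)%:C) rmorph_nat.
have Kt : K (polar 0 t) = (2 + 2 * cos t)%:C.
  rewrite /K /polar expR0 !mul1r twoE.
  apply/eqP; rewrite eq_complex /= cos2Dsin2 !divr1.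
  by apply/andP; split; apply/eqP; ring.
have Ht : complex.Re (H (polar 0 t)) = - u0 * (2 + 2 * cos t).
  by rewrite /H /polar expR0 !mul1r twoE /=; ring.
rewrite Ht /G Kt.
have k0 : 0 <= 2 + 2 * cos t by have := cos_geN1 t; lra.
have := g0 (polar 0 t); rewrite normc_polar expR0 => /(_ (lexx _)).
rewrite /u0; case: (g _) => a b; case: (g 0) => a0 b0 /= ha.
by rewrite mulr0 subr0 ler_wpM2r// lerDr.
Qed.

(** * Harnack's inequality *)

Lemma is_derive_approx {R : realType} (f : R -> R) (x c : R) :
  (forall e, 0 < e -> exists2 r, 0 < r &
    forall h, `|h| < r -> `|f (x + h) - f x - c * h| <= e * `|h|) ->
  is_derive x 1 f c.
Proof.
move=> fc; suff cf : (fun h => h^-1 *: (f (h *: 1 + x) - f x)) @ 0^' --> c.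
  by split; [exact: (cvgP _ cf)|exact: (cvg_lim _ cf)].
apply/cvgrPdist_le => e e0; have [r r0 hr] := fc e e0.
apply/nbhs_ballP; exists r => //= h; rewrite /ball/= sub0r normrN => hh h0.
have {}hr := hr h hh; rewrite /GRing.scale/= mulr1 [h + x]addrC.
rewrite distrC (_ : h^-1 * _ - c = h^-1 * (f (x + h) - f x - c * h)); last by field.
by rewrite normrM normfV mulrC ler_pdivrMr ?normr_gt0.
Qed.

(** The inequality f' >= - 2 f says that exp (2 t) f t is nondecreasing. *)
Lemma exponential_lower_bound {R : realType} (f df : R -> R) :
  (forall t : R, 0 <= t <= 1 -> is_derive t 1 f (df t)) ->
  (forall t, 0 <= t <= 1 -> - (2 * f t) <= df t) ->
  f 0 <= expR 2 * f 1.
Proof.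
move=> dfE fdf; pose F t := expR (2 * t) * f t.
have dF (t : R) : 0 <= t <= 1 ->
    is_derive t 1 F (expR (2 * t) * df t + (2 * expR (2 * t)) * f t).
  move=> ht; have := dfE t ht => ?.
  have d2 : is_derive t 1 (fun t : R => 2 * t) (2 : R).
    by apply: is_derive_eq; rewrite /GRing.scale/=; ring.
  have de : is_derive t 1 (fun t : R => expR (2 * t)) (expR (2 * t) * 2).
    exact: (@is_derive1_comp _ expR (fun t : R => 2 * t)).
  apply: is_derive_eq; rewrite /GRing.scale/=; ring.
suff : F 0 <= F 1 by rewrite /F mulr0 expR0 mul1r mulr1.
have [t|| t] := MVT_segment ler01 (f := F)
  (df := fun t => expR (2 * t) * df t + (2 * expR (2 * t)) * f t).
- by rewrite in_itv/= => /andP[t0 t1]; apply: dF; rewrite !ltW.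
- apply: continuous_in_subspaceT => t; rewrite inE/= in_itv/= => /dF [+ _].
  by move=> /derivable1_diffP; exact: differentiable_continuous.
rewrite in_itv/= => ht E; rewrite -subr_ge0 E subr0 mulr1.
have := fdf t ht; have := expR_ge0 (2 * t); move: (expR _) => k k0 hk.
rewrite [2 * k]mulrC -mulrA -mulrDr mulr_ge0//; move: hk; clear; lra.
Qed.

(** In the complex line through p and p + h, with |h| as unit of length, the disc
of radius 2 around p contains the unit discs around all points of the segment
from p to p + h, so that the derivative bound holds along this segment. *)
Lemma Harnack_segment {R : realType} {V : normedModType R[i]} (g : V -> R[i])
    (p h : V) :
  (forall z, normc z <= 2 -> differentiable g (p + z *: h)) ->
  (forall z, normc z <= 2 -> 0 <= complex.Re (g (p + z *: h))) ->
  complex.Re (g p) <= expR 2 * complex.Re (g (p + h)).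
Proof.
move=> dg g0.
pose G (t : R) (z : R[i]) := g (p + (t%:C + z) *: h).
have ball2 (t : R) z : 0 <= t <= 1 -> normc z <= 1 -> normc (t%:C + z) <= 2.
  move=> /andP[t0 t1] z1; apply: (le_trans (normcD _ _)).
  rewrite -[2]/(1 + 1) lerD//= expr0n/= addr0 sqrtr_sqr ger0_norm//.
have dG t z : 0 <= t <= 1 -> normc z <= 1 -> differentiable (G t) z.
  move=> ht hz; apply: (@differentiable_comp _ _ _ _ (fun z => p + (t%:C + z) *: h) g).
    apply: differentiableD => //.
    by apply: differentiableZl; apply: differentiableD.
  exact: dg (ball2 _ _ ht hz).
pose f (t : R) := complex.Re (g (p + t%:C *: h)).
have df (t : R) : 0 <= t <= 1 -> is_derive t 1 f (complex.Re ('d (G t) 0 1)).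
  move=> ht; apply: is_derive_approx => e e0.
  have n0 : normc (0 : R[i]) <= 1 by rewrite normc0.
  have [r r0 hr] := complex_derivative_approx (dG t 0 ht n0) e0.
  exists r => // k hk; have := hr k%:C; rewrite subr0.
  have -> : normc (k%:C) = `|k| by rewrite /= expr0n/= addr0 sqrtr_sqr.
  move=> /(_ hk); apply: le_trans.
  rewrite /f /G addr0 rmorphD.
  set u := g _; set v := g _; set w := 'd _ _ _.
  have [+ _] := ReIm_le_normc (u - v - w * k%:C).
  apply: le_trans; rewrite le_eqVlt; apply/orP; left; apply/eqP; congr `|_|.
  by case: u => ? ?; case: v => ? ?; case: w => ? ? /=; ring.
have := @exponential_lower_bound R f _ df.
rewrite /f scale0r addr0 scale1r; apply=> t ht.
have := @derivative_lower_bound R (G t) (fun z hz => dG t z ht hz).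
rewrite /G addr0; apply=> z hz; exact: g0 (ball2 _ _ ht hz).
Qed.

(** Harnack's inequality is a statement about positive pluriharmonic functions;
here these are the real parts of holomorphic functions. *)
Definition positive_real_part {R : realType} {V : normedModType R[i]}
    (D : set V) (g : V -> R[i]) :=
  forall x, D x -> differentiable g x /\ 0 <= complex.Re (g x).

(** If the ball of radius r around x lies in D and |x - y| < r / 3, the discs of
[Harnack_segment] for the segments from x to y and from y to x lie in D. *)
Lemma Harnack_local {R : realType} {V : normedModType R[i]} (D : set V) (x : V) :
  open D -> D x -> \forall y \near x, D y /\
    forall g : V -> R[i], positive_real_part D g ->
      complex.Re (g x) <= expR 2 * complex.Re (g y) /\
      complex.Re (g y) <= expR 2 * complex.Re (g x).
Proof.
move=> oD Dx; have /nbhs_ballP[r /= r0 rD] : nbhs x D by exact: open_nbhs_nbhs.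
apply/nbhs_ballP; exists (r / 3) => [|y]/=; first by rewrite divr_gt0.
rewrite -ball_normE /ball_/= ltr_pdivlMr// => yx.
have seg p q : `|x - p| <= `|x - y| -> `|q - p| = `|x - y| ->
    forall z : R[i], normc z <= 2 -> D (p + z *: (q - p)).
  move=> xp qp z z2; apply: rD; rewrite -ball_normE /ball_/=.
  apply: le_lt_trans yx; rewrite opprD addrA (le_trans (ler_normB _ _))//.
  rewrite normrZ qp (_ : _ * 3 = `|x - y| + 2 * `|x - y|); last by ring.
  rewrite lerD// ler_wpM2r// normC_normc.
  by rewrite -[2](rmorph_nat (real_complex R)) lecR.
split.
  by apply: rD; rewrite -ball_normE /ball_/=; apply: le_lt_trans yx; rewrite ler_peMr// ler1n.
move=> g gD; split.
  rewrite -[in leRHS](subrKC x y); apply: Harnack_segment => z z2;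
    by have [] := gD _ (seg x y _ _ z z2); rewrite ?subrr ?normr0 ?[`|y - x|]distrC.
rewrite -[in leRHS](subrKC y x); apply: Harnack_segment => z z2;
  by have [] := gD _ (seg y x _ _ z z2).
Qed.

(** The points x where some d > 0 works for all g form an open set, and so do
the points of D where none does, because the local constant exp 2 works in both
directions. *)
Lemma Harnack_connected {R : realType} {V : normedModType R[i]} (D : set V)
    (a x : V) : open D -> connected D -> D a -> D x ->
  exists2 d : R, 0 < d & \forall y \near x, forall g : V -> R[i],
    positive_real_part D g -> d * complex.Re (g a) <= complex.Re (g y).
Proof.
move=> oD cD Da Dx.
pose good d y := forall g : V -> R[i], positive_real_part D g ->
  d * complex.Re (g a) <= complex.Re (g y).
pose B := [set y | D y /\ exists2 d : R, 0 < d & good d y].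
have step d y y' : good d y -> (forall g : V -> R[i], positive_real_part D g ->
    complex.Re (g y) <= expR 2 * complex.Re (g y')) -> good (d / expR 2) y'.
  move=> gy yy' g gD; rewrite mulrAC ler_pdivrMr ?expR_gt0// mulrC.
  by rewrite mulrC; apply: le_trans (gy _ gD) _; rewrite mulrC; exact: yy'.
have d2 d : 0 < d -> 0 < d / expR 2 :> R by move=> d0; rewrite divr_gt0 ?expR_gt0.
have BD : B = D.
  apply: cD.
  - exists a; split=> //; exists 1 => // g _; by rewrite mul1r.
  - exists B; last by apply/seteqP; split=> y // -[].
    rewrite openE => y [Dy [d d0 dy]]; near=> y'.
    have [Dy' H] : D y' /\ forall g : V -> R[i], positive_real_part D g ->
      complex.Re (g y) <= expR 2 * complex.Re (g y') /\
      complex.Re (g y') <= expR 2 * complex.Re (g y).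
      by near: y'; exact: Harnack_local.
    by split=> //; exists (d / expR 2); [exact: d2|apply: step dy _ => g /H[]].
  - exists (~` (D `\` B)); last first.
      apply/seteqP; split => y; first by move=> By; split; [case: By|case].
      by move=> [Dy nDB]; apply: contrapT => nBy; exact: nDB.
    apply: open_closedC; rewrite openE => y [Dy nBy]; near=> y'.
    have [Dy' H] : D y' /\ forall g : V -> R[i], positive_real_part D g ->
      complex.Re (g y) <= expR 2 * complex.Re (g y') /\
      complex.Re (g y') <= expR 2 * complex.Re (g y).
      by near: y'; exact: Harnack_local.
    split=> // -[_ [d d0 dy']]; apply: nBy; split=> //.
    by exists (d / expR 2); [exact: d2|apply: step dy' _ => g /H[]].
have [_ [d d0 dx]] : B x by rewrite BD.
exists (d / expR 2); first exact: d2.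
have := Harnack_local oD Dx; apply: filterS => y [_ H].
by apply: step dx _ => g /H[].
Unshelve. all: by end_near. Qed.

(** The local constants of [Harnack_connected] become one: near each x in K every
small enough d works, and compactness makes this uniform in x. *)
Lemma Harnack_compact_image {R : realType} {V : normedModType R[i]} (D K : set V)
    (f : V -> V) (a : V) : open D -> connected D -> D a -> compact K ->
  (forall x, K x -> D (f x) /\ {for x, continuous f}) ->
  exists2 d : R, 0 < d & forall x, K x -> forall g : V -> R[i],
    positive_real_part D g -> d * complex.Re (g a) <= complex.Re (g (f x)).
Proof.
move=> oD cD Da /compact_near_coveringP cK fK.
pose P (d : R) x := forall g : V -> R[i],
    positive_real_part D g -> d * complex.Re (g a) <= complex.Re (g (f x)).
have : \forall d \near 0^'+, forall x, K x -> P d x.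
  apply: cK => x Kx; have [Dfx cf] := fK x Kx.
  have [d0 d00 H] := Harnack_connected oD cD Da Dfx.
  near=> x' d => g gD.
  have d_le : d <= d0 by near: d; exact: nbhs_right_le.
  apply: (@le_trans _ _ (d0 * complex.Re (g a))).
    by rewrite ler_wpM2r//; have [] := gD a Da.
  have : forall g : V -> R[i], positive_real_part D g ->
    d0 * complex.Re (g a) <= complex.Re (g (f x')) by near: x'; exact: cf H.
  exact.
move=> H; have [d [d0 Hd]] : exists d : R, 0 < d /\ forall x, K x -> P d x.
  near (0 : R)^'+ => d; exists d; split; first by near: d; exact: nbhs_right_gt.
  by near: d.
by exists d.
Unshelve. all: by end_near. Qed.

(** * Compactness of the closure *)

Lemma Complex_continuous {R : realType} :
  continuous (fun p : R * R => p.1 +i* p.2 : R[i]).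
Proof.
move=> [x y]; apply/cvgrPdist_le => e e0.
have eR : e = (complex.Re e)%:C by rewrite RRe_real// gtr0_real.
have r0 : 0 < complex.Re e by rewrite -ltcR -eR.
have r2 : 0 < complex.Re e / 2 by rewrite divr_gt0.
near=> p; rewrite eR normC_normc lecR; apply: le_trans (normc_le_ReIm _) _ => /=.
rewrite [leRHS]splitr lerD// ltW//; near: p.
  by apply: cvgr_dist_lt r2; exact: cvg_fst.
by apply: cvgr_dist_lt r2; exact: cvg_snd.
Unshelve. all: by end_near. Qed.

(** The Heine-Borel property of C^N, obtained from the one of R: a product of
squares of the complex plane is compact and closed. *)
Lemma bounded_closure_compact {R : realType} (N : nat) (D : set 'rV[R[i]]_N)
    (M : R) : (forall x, D x -> forall i, normc (x ord0 i) <= M) ->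
  compact (closure D).
Proof.
move=> DM.
pose A := (fun p : R * R => p.1 +i* p.2 : R[i]) @` (`[- M, M] `*` `[- M, M]).
have cA : compact A.
  apply: continuous_compact.
    by apply: continuous_subspaceT => p; exact: Complex_continuous.
  by apply: compact_setX; exact: segment_compact.
have cK : compact [set v : 'rV[R[i]]_N | forall i, A (v ord0 i)].
  by apply: (@rV_compact R[i] N (fun=> A)).
apply: (subclosed_compact _ cK); first exact: closed_closure.
rewrite closureE => v; apply; split; first by apply: compact_closed cK; exact: norm_hausdorff.
move=> x /DM xM i; have [xr xi] := ReIm_le_normc (x ord0 i).
exists (complex.Re (x ord0 i), complex.Im (x ord0 i)); last by case: (x ord0 i).
by split; rewrite /= in_itv/= -ler_norml; [exact: le_trans xr _|exact: le_trans xi _].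
Qed.

Lemma bounded_coords {R : realType} (N : nat) (D : set 'rV[R[i]]_N) :
  bounded_set D -> exists2 M : R, 0 < M &
    forall x, D x -> forall i, normc (x ord0 i) <= M.
Proof.
move=> /pinfty_ex_gt0[M M0 DM].
have MR : M = (complex.Re M)%:C by rewrite RRe_real// gtr0_real.
exists (complex.Re M); first by rewrite -ltcR -MR.
move=> x Dx i; rewrite -lecR -MR; apply: le_trans (DM x Dx).
rewrite -normC_normc [leRHS]mx_normE -[leLHS]nngE num_le.
exact: (le_bigmax _ (fun ij => `|x ij.1 ij.2|%:nng) (ord0, i)).
Qed.

(** * Maps with relatively compact image *)

(** The contraction argument.  The hypothesis on d is the uniform Harnack bound
on the image of f; applied to 1 + g and 1 - g it gives |Re (g o f)| <= 1 - d,
so that g o f stays in the family after multiplication by c = 1 / (1 - d / 2),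
while its value at the fixed point b is multiplied by c > 1.  The supremum of
these values is finite and at least c times itself, hence at most 0. *)
Lemma fixed_points_not_separated {R : realType} {V : normedModType R[i]}
  (D : set V) (f : V -> V) (a b : V) (d : R) (g0 : V -> R[i]) :
  D a -> D b -> f a = a -> f b = b -> 0 < d ->
  (forall x, D x -> D (f x) /\ differentiable f x) ->
  (forall x, D x -> forall g : V -> R[i],
     positive_real_part D g -> d * complex.Re (g a) <= complex.Re (g (f x))) ->
  (forall x, D x -> differentiable g0 x /\ `|complex.Re (g0 x)| <= 1) ->
  complex.Re (g0 a) = 0 -> complex.Re (g0 b) <= 0.
Proof.
move=> Da Db fa fb d0 fD har g0D g0a.
pose G (g : V -> R[i]) := (forall x, D x -> differentiable g x /\
  `|complex.Re (g x)| <= 1) /\ complex.Re (g a) = 0.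
have d1 : d <= 1.
  have := har a Da (cst 1); rewrite /= mulr1; apply=> x _; split=> //=.
(* d / 2 instead of d, as d = 1 is possible and 1 - d has to be inverted. *)
pose c := (1 - d / 2)^-1.
have c0 : 0 < c by rewrite invr_gt0; move: d1; clear; lra.
have one (g : R[i]) : complex.Re (1 + g) = 1 + complex.Re g by case: g.
have oneB (g : R[i]) : complex.Re (1 - g) = 1 - complex.Re g by case: g.
have cRe (k : R) (g : R[i]) : complex.Re (k%:C * g) = k * complex.Re g.
  by case: g => u v /=; rewrite mul0r subr0.
have G_pullback g : G g -> G (fun x => c%:C * g (f x)).
  move=> [gD ga]; split=> [x Dx|]; last by rewrite fa cRe ga mulr0.
  have [Dfx dfx] := fD x Dx; have [dg g1] := gD _ Dfx; split.
    by apply: differentiableM => //; exact: (differentiable_comp dfx dg).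
  have up : d <= 1 + complex.Re (g (f x)).
    have := har x Dx (fun x => 1 + g x); rewrite !one ga addr0 mulr1; apply=> y Dy.
    have [dgy] := gD y Dy; rewrite ler_norml => /andP[gy _]; split.
      exact: differentiableD.
    by rewrite one -lerBlDl sub0r.
  have low : d <= 1 - complex.Re (g (f x)).
    have := har x Dx (fun x => 1 - g x); rewrite !oneB ga subr0 mulr1; apply=> y Dy.
    have [dgy] := gD y Dy; rewrite ler_norml => /andP[_ gy]; split.
      exact: differentiableB.
    by rewrite oneB subr_ge0.
  rewrite cRe normrM gtr0_norm// ler_pdivrMl ?mulr1; last by move: d1; clear; lra.
  by rewrite ler_norml; apply/andP; split; move: up low d0; clear; lra.
pose S := [set complex.Re (g b) | g in G].
have S1 : ubound S 1.
  by move=> _ [g [gD _] <-]; have [_] := gD b Db; apply: le_trans; exact: ler_norm.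
have Sg0 : S (complex.Re (g0 b)) by exists g0.
have supS : has_sup S by split; [exists (complex.Re (g0 b))|exists 1].
have S_scale r : S r -> S (c * r).
  by move=> [g Gg <-]; exists (fun x => c%:C * g (f x)); [exact: G_pullback|rewrite fb cRe].
have sup_le : sup S <= c^-1 * sup S.
  apply: ge_sup; first by exists (complex.Re (g0 b)).
  move=> r Sr; rewrite ler_pdivlMl//; apply: ub_le_sup; [by exists 1|exact: S_scale].
have := ub_le_sup supS.2 Sg0 => /le_trans; apply.
move: sup_le; rewrite /c invrK; move: d0; clear => d0.
rewrite mulrBl mul1r lerBrDl gerDr => h.
by rewrite -(pmulr_rle0 _ (divr_gt0 d0 (ltr0Sn _ 1))).
Qed.

Lemma exists_bounded_separating_function {R : realType} (N : nat)
    (D : set 'rV[R[i]]_N) (a b : 'rV[R[i]]_N) (M : R) :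
  0 < M -> (forall x, D x -> forall i, normc (x ord0 i) <= M) -> D a -> a != b ->
  exists g : 'rV[R[i]]_N -> R[i],
    [/\ forall x, D x -> differentiable g x /\ `|complex.Re (g x)| <= 1,
        complex.Re (g a) = 0 & 0 < complex.Re (g b)].
Proof.
move=> M0 DM Da ab.
have [i abi] : exists i, a ord0 i != b ord0 i.
  apply: contrapT => h; move/eqP : ab; apply; apply/rowP => i.
  by apply/eqP; apply: contrapT => /negP abi; apply: h; exists i.
pose u := b ord0 i - a ord0 i.
have u0 : u != 0 by rewrite subr_eq0 eq_sym.
have nu : 0 < normc u.
  by rewrite lt_def normc_ge0 andbT; apply: contra u0 => /eqP/eq0_normc ->.
(* k u is a positive real, and |k| = 1 / (2 M) keeps the values in the unit disc. *)
pose k := (normc u / (2 * M))%:C / u.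
exists (fun x => k * (x ord0 i - a ord0 i)); split.
- move=> x Dx; split.
    apply: differentiableM => //; apply: differentiableB => //.
    exact: differentiable_coord.
  have [h _] := ReIm_le_normc (k * (x ord0 i - a ord0 i)); apply: le_trans h _.
  rewrite normcM.
  have -> : normc k = (2 * M)^-1.
    rewrite /k normcM normcV /= expr0n/= addr0 sqrtr_sqr ger0_norm; last first.
      by rewrite divr_ge0 ?normc_ge0// mulr_ge0// ltW.
    by field; rewrite !lt0r_neq0.
  rewrite ler_pdivrMl ?mulr_gt0// mulr1 (le_trans (normcD _ _))//.
  rewrite normcN mulr_natl mulr2n lerD//; exact: DM.
- by rewrite subrr mulr0.
- by rewrite -/u /k divfK//= divr_gt0// mulr_gt0.
Qed.

Theorem proposition24 (R : realType) (N : nat) (D : set 'rV[R[i]]_N)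
    (domD : domain D) (bndD : bounded_set D) (m : nat) (hm : (2 <= m)%N) :
  m_extremal m D D id.
Proof.
have [_ oD cD] := domD.
have idD : holomorphic_map D D id by split.
split=> // lambda lD linj; split; first by exists id.
move=> U oU DU [f [[fD df] flam]].
have [m0 m1] : (0 < m)%N /\ (1 < m)%N by split => //; exact: ltnW.
pose i0 := Ordinal m0; pose i1 := Ordinal m1.
have ab : lambda i0 != lambda i1 by apply/eqP => /linj.
have [M M0 DM] := bounded_coords bndD.
have UD x : D x -> U x by move=> Dx; apply: DU; exact: subset_closure.
have [d d0 har] := Harnack_compact_image oD cD (lD i0) (bounded_closure_compact DM)
  (fun x hx => conj (fD x (DU x hx)) (differentiable_continuous (df x (DU x hx)))).
have [g [gD ga gb]] := exists_bounded_separating_function M0 DM (lD i0) ab.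
suff : complex.Re (g (lambda i1)) <= 0 by rewrite leNgt gb.
apply: (fixed_points_not_separated (lD i0) (lD i1) (flam i0) (flam i1) d0) => //.
- by move=> x Dx; split; [exact: fD (UD x Dx)|exact: df (UD x Dx)].
- by move=> x Dx; apply: har; exact: subset_closure.
Qed.
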